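(* Let $e$ and $f$ be atomic expressions, i.e. each is either a well-formed power term $S.\mathbf{P}_U$ or one of the constants $S_\emptyset.\mathbf{P}_\emptyset$, $S_I.\mathbf{P}_\emptyset$. Then there exists a power term polynomial $\pi$ containing at most three atomic terms (each a well-formed power term or one of the two constants) such that $[\![\pi]\!]=[\![e]\!]\cdot[\![f]\!]$, i.e. the product $e\odot f$ is semantically equivalent to $\pi$.
   Context: Let $\mathcal{D}=\{x_1,\dots,x_n\}$ be Boolean variables and consider Boolean polynomials in $\mathbb{F}_2[x_1,\dots,x_n]/(x_i^2-x_i: i\in[n])$, with product denoted $\cdot$. For $W\subseteq\mathcal{D}$ let $m_W=\prod_{x\in W}x$ ($m_\emptyset=1$). For $U\subseteq\mathcal{D}$ the modified power set is $\mathbf{P}_U=\{\emptyset\}$ if $U=\emptyset$ and $\mathbf{P}_U=\{A\subseteq U: A\neq\emptyset\}$ otherwise. A well-formed power term is $S.\mathbf{P}_U$ with $S,U\subseteq\mathcal{D}$, $S\cap U=\emptyset$, $|U|\neq 1$, $(S,U)\neq(\emptyset,\emptyset)$; its semantics is $[\![S.\mathbf{P}_U]\!]=\sum_{A\in\mathbf{P}_U}m_{S\cup A}$. The constants $S_\emptyset.\mathbf{P}_\emptyset$ and $S_I.\mathbf{P}_\emptyset$ have semantics $0$ and $1$. A power term polynomial is a formal expression built from atomic terms by a commutative, associative operator $\uplus$ with identity $S_\emptyset.\mathbf{P}_\emptyset$ and $\pi\uplus\pi=S_\emptyset.\mathbf{P}_\emptyset$, with semantics $[\![\pi\uplus\rho]\!]=[\![\pi]\!]+[\![\rho]\!]$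 over $\mathbb{F}_2$. The product operator $\odot$ on expressions has semantics $[\![e\odot f]\!]=[\![e]\!]\cdot[\![f]\!]$. *)

(* Defs.v *)
From HB Require Import structures.
From mathcomp Require Import all_boot all_order all_algebra.
From mathcomp Require Import ring_quotient.
From mathcomp Require Import boolp.
From mathcomp Require Import mpoly.

Set Implicit Arguments.
Unset Strict Implicit.
Unset Printing Implicit Defensive.

Import GRing.Theory.

Local Open Scope ring_scope.
Local Open Scope quotient_scope.

(* The ideal (X_i ^ 2 - X_i : i < n) of F_2[X_0, ..., X_(n-1)].  Quotients in
   ring_quotient require a bool-valued ideal, hence the classical asbool. *)
Definition idem_ideal (n : nat) : {pred {mpoly 'F_2[n]}} :=
  fun p => `[< exists c : 'I_n -> {mpoly 'F_2[n]},
                 p = \sum_(i < n) c i * ('X_i ^+ 2 - 'X_i) >].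

Lemma idem_ideal_closed n : idealr_closed (@idem_ideal n).
Proof.
split.
- by apply/asboolP; exists (fun=> 0); rewrite big1 // => i _; rewrite mul0r.
- apply/asboolP => -[c /(congr1 (meval (fun=> 0)))].
  rewrite rmorph1 rmorph_sum big1 => [/eqP|i _]; first by rewrite oner_eq0.
  by rewrite rmorphM rmorphB rmorphXn /= mevalXU expr0n subrr mulr0.
- move=> a u v /asboolP[c ->] /asboolP[d ->]; apply/asboolP.
  exists (fun i => a * c i + d i); rewrite mulr_sumr -big_split /=.
  by apply: eq_bigr => i _; rewrite mulrDl mulrA.
Qed.

HB.instance Definition _ n :=
  isIdealr.Build {mpoly 'F_2[n]} (@idem_ideal n) (@idem_ideal_closed n).

Definition boolPoly (n : nat) : comNzRingType :=
  {ideal_quot (@idem_ideal n : idealr {mpoly 'F_2[n]})}.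

Definition bvar (n : nat) (i : 'I_n) : boolPoly n :=
  \pi_({ideal_quot (@idem_ideal n : idealr {mpoly 'F_2[n]})}) 'X_i.

Definition mon (n : nat) (W : {set 'I_n}) : boolPoly n := \prod_(i in W) bvar i.

(* The modified power set: nonempty subsets of U, except that the empty set is
   sent to {set0} rather than to the empty family. *)
Definition mpowerset (n : nat) (U : {set 'I_n}) : {set {set 'I_n}} :=
  if U == set0 then [set set0] else [set A in powerset U | A != set0].

Definition wf_power (n : nat) (S U : {set 'I_n}) : bool :=
  [&& [disjoint S & U], #|U| != 1%N & (S, U) != (set0, set0)].

Inductive atomic (n : nat) : Type :=
| PZero
| POne
| Power (S U : {set 'I_n}) of wf_power S U.

Arguments PZero {n}.
Arguments POne {n}.

Definition atomic_sem (n : nat) (a : atomic n) : boolPoly n :=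
  match a with
  | PZero => 0
  | POne => 1
  | Power T U _ => \sum_(A in mpowerset U) mon (T :|: A)
  end.

Inductive expr (n : nat) : Type :=
| Atom of atomic n
| Uplus of expr n & expr n
| Odot of expr n & expr n.

Fixpoint sem (n : nat) (e : expr n) : boolPoly n :=
  match e with
  | Atom a => atomic_sem a
  | Uplus e1 e2 => sem e1 + sem e2
  | Odot e1 e2 => sem e1 * sem e2
  end.

Definition sem_equiv (n : nat) (e f : expr n) : Prop := sem e = sem f.

(* Power term polynomials are the expressions built with Uplus only. *)
Fixpoint is_ptp (n : nat) (e : expr n) : bool :=
  match e with
  | Atom _ => true
  | Uplus e1 e2 => is_ptp e1 && is_ptp e2
  | Odot _ _ => false
  end.

(* Number of occurrences of atomic terms, constants and repetitions included. *)
Fixpoint natoms (n : nat) (e : expr n) : nat :=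
  match e with
  | Atom _ => 1
  | Uplus e1 e2 | Odot e1 e2 => natoms e1 + natoms e2
  end.

(* Expressions are raw syntax; the laws imposed on Uplus generate the congruence
   ptp_eq, under which the semantics is invariant (ptp_eq_sem).  Counting atoms
   on a raw representative bounds the count up to this congruence from above. *)
Inductive ptp_eq (n : nat) : expr n -> expr n -> Prop :=
| ptp_refl p : ptp_eq p p
| ptp_sym p q : ptp_eq p q -> ptp_eq q p
| ptp_trans p q r : ptp_eq p q -> ptp_eq q r -> ptp_eq p r
| ptp_congr p p' q q' :
    ptp_eq p p' -> ptp_eq q q' -> ptp_eq (Uplus p q) (Uplus p' q')
| ptp_comm p q : ptp_eq (Uplus p q) (Uplus q p)
| ptp_assoc p q r : ptp_eq (Uplus p (Uplus q r)) (Uplus (Uplus p q) r)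
| ptp_unit p : ptp_eq (Uplus (Atom PZero) p) p
| ptp_nilp p : ptp_eq (Uplus p p) (Atom PZero).

Lemma boolPoly_addrr n (x : boolPoly n) : x + x = 0.
Proof.
suff two0 : 1 + 1 = 0 :> {mpoly 'F_2[n]}.
  elim/quotW: x => p.
  by rewrite -[LHS]pi_addr -[p]mulr1 -mulrDr two0 mulr0 pi_zeror.
rewrite -mpolyC1 -mpolyCD (_ : 1 + 1 = 0 :> 'F_2) ?mpolyC0 //; exact: val_inj.
Qed.

Lemma ptp_eq_sem n (p q : expr n) : ptp_eq p q -> sem_equiv p q.
Proof.
rewrite /sem_equiv; elim=> {p q} //=.
- by move=> p q r _ -> _ ->.
- by move=> p p' q q' _ -> _ ->.
- by move=> p q; rewrite addrC.
- by move=> p q r; rewrite addrA.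
- by move=> p; rewrite add0r.
- by move=> p; rewrite boolPoly_addrr.
Qed.

(* Main.v *)
(** Writing [N_U] for [\prod_(i in U) (1 + x_i)], expansion over subsets gives
    [[S.P_U] = m_S * (1 + N_U)] when [U] is nonempty.  Both [m] and [N] turn
    unions into products, by idempotence of the variables, and
    [m_S * N_V = 0] when [S] meets [V] because [x * (1 + x) = 0].  Hence a factor
    [P_V] with [V] meeting [S] can be replaced by [P_set0], and otherwise the
    product follows from
    [(1 + N_U) * (1 + N_V) = (1 + N_U) + (1 + N_V) + (1 + N_(U :|: V))]. *)
Require Import Defs.
From mathcomp Require Import all_boot all_order all_algebra.
From mathcomp Require Import ring_quotient boolp mpoly.

Import GRing.Theory.

Local Open Scope ring_scope.

Lemma bvar_idem n (i : 'I_n) : bvar i * bvar i = bvar i.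
Proof.
rewrite /bvar -[LHS]pi_mulr; apply/eqquotP; apply/asboolP.
(* The difference is the [i]-th generator of the ideal, so the coefficient family is the indicator
   of [i]. *)
exists (fun j => if j == i then 1 else 0).
rewrite (bigD1 i) //= eqxx mul1r big1 ?addr0 ?expr2 // => j /negPf ->.
by rewrite mul0r.
Qed.

Lemma bvar_compl_idem n (i : 'I_n) :
  (1 + bvar i) * (1 + bvar i) = 1 + bvar i.
Proof.
by rewrite mulrDl mul1r mulrDr mulr1 bvar_idem boolPoly_addrr addr0.
Qed.

Lemma disjoint_setU (T : finType) (A B C : {set T}) :
  [disjoint A :|: B & C] = [disjoint A & C] && [disjoint B & C].
Proof. by rewrite -!setI_eq0 setIUl setU_eq0. Qed.

Lemma prod_setU_idem (R : comPzRingType) (I : finType) (F : I -> R)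
    (A B : {set I}) (idemF : forall i, F i * F i = F i) :
  \prod_(i in A :|: B) F i = (\prod_(i in A) F i) * (\prod_(i in B) F i).
Proof.
rewrite !(big_mkcond (fun i => i \in _)) -big_split; apply: eq_bigr => i _ /=.
by rewrite inE; case: (i \in A); case: (i \in B); rewrite ?idemF ?mulr1 ?mul1r.
Qed.

(** This is $N_U$, the Boolean indicator that all variables of [U] vanish. *)
Definition cmon n (U : {set 'I_n}) : boolPoly n :=
  \prod_(i in U) (1 + bvar i).

Lemma mon_setU n (A B : {set 'I_n}) : mon (A :|: B) = mon A * mon B.
Proof. exact/prod_setU_idem/bvar_idem. Qed.

Lemma cmon_setU n (A B : {set 'I_n}) : cmon n (A :|: B) = cmon n A * cmon n B.
Proof. exact/prod_setU_idem/bvar_compl_idem. Qed.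

Lemma cmon_powerset n (U : {set 'I_n}) :
  cmon n U = \sum_(A in powerset U) mon A.
Proof.
(* Extending by 0 outside [U] makes the product run over all indices, so that [bigA_distr] applies;
   a set not contained in [U] then contributes a zero factor. *)
pose F i : boolPoly n := if i \in U then bvar i else 0.
have -> : cmon n U = \prod_i (F i + 1).
  rewrite /cmon big_mkcond; apply: eq_bigr => i _; rewrite /F.
  by case: ifP; rewrite ?add0r // addrC.
rewrite bigA_distr /= [RHS]big_mkcond; apply: eq_bigr => A _.
rewrite powersetE -big_mkcond /=; case: ifPn => [/subsetP AU|].
  by apply: eq_bigr => i /AU; rewrite /F => ->.
by case/subsetPn => i iA iU; rewrite (bigD1 i) //= /F (negPf iU) mul0r.
Qed.

Lemma mon_mul_cmon n (S V : {set 'I_n}) :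
  ~~ [disjoint S & V] -> mon S * cmon n V = 0.
Proof.
case/pred0Pn => i /andP[/= iS iV].
rewrite /mon /cmon (bigD1 i iS) (bigD1 i iV) /= mulrACA mulrDr mulr1 bvar_idem.
by rewrite boolPoly_addrr mul0r.
Qed.

Lemma mon0 n : mon set0 = 1 :> boolPoly n.
Proof. exact: big_set0. Qed.

(** For nonempty [U] this is the disjunction of the variables of [U]; for empty [U] it is 1, not the
    empty disjunction 0, so that case is treated apart. *)
Definition pset_sem n (U : {set 'I_n}) : boolPoly n :=
  \sum_(A in mpowerset U) mon A.

Lemma pset_sem0 n : pset_sem n set0 = 1.
Proof. by rewrite /pset_sem /mpowerset eqxx big_set1 mon0. Qed.

Lemma pset_sem_cmon n (U : {set 'I_n}) :
  U != set0 -> pset_sem n U = 1 + cmon n U.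
Proof.
move=> U0; rewrite /pset_sem /mpowerset (negPf U0) cmon_powerset.
rewrite [in RHS](bigD1 set0) /= ?powersetE ?sub0set //.
rewrite mon0 addrA boolPoly_addrr add0r.
by apply: eq_bigl => A; rewrite !inE.
Qed.

Lemma power_sem n (S U : {set 'I_n}) :
  \sum_(A in mpowerset U) mon (S :|: A) = mon S * pset_sem n U.
Proof. by rewrite mulr_sumr; apply: eq_bigr => A _; rewrite mon_setU. Qed.

Lemma mon_mul_pset n (S V : {set 'I_n}) :
  ~~ [disjoint S & V] -> mon S * pset_sem n V = mon S.
Proof.
move=> SV; have V0 : V != set0.
  by apply: contraNneq SV => ->; rewrite disjoint_sym disjoints_subset sub0set.
by rewrite pset_sem_cmon // mulrDr mulr1 mon_mul_cmon // addr0.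
Qed.

Lemma pset_semM n (U V : {set 'I_n}) : U != set0 -> V != set0 ->
  pset_sem n U * pset_sem n V =
  pset_sem n U + (pset_sem n V + pset_sem n (U :|: V)).
Proof.
move=> U0 V0; have UV0 : U :|: V != set0 by rewrite setU_eq0 negb_and U0.
rewrite !pset_sem_cmon // cmon_setU mulrDl mul1r mulrDr mulr1 -!addrA.
rewrite (addrCA (cmon n V) 1) [1 + (1 + _)]addrA boolPoly_addrr add0r.
by congr (_ + _); rewrite addrCA.
Qed.

(** The pair of empty sets is not a well-formed power term, but its value 1 is that of the constant
    [POne]. *)
Lemma atomic_of_sets n (S U : {set 'I_n}) :
  [disjoint S & U] -> #|U| != 1%N ->
  exists a : atomic n, atomic_sem a = mon S * pset_sem n U.
Proof.
move=> dSU U1; case: (eqVneq (S, U) (set0, set0)) => [[-> ->]|SU0].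
  by exists POne; rewrite pset_sem0 mulr1 mon0.
have wf : wf_power S U by apply/and3P.
by exists (Power wf); apply: power_sem.
Qed.

Lemma ptp_of_sets n (W U V : {set 'I_n}) :
    [disjoint W & U] -> [disjoint W & V] -> #|U| != 1%N -> #|V| != 1%N ->
  exists p : expr n, [/\ is_ptp p, (natoms p <= 3)%N
    & sem p = mon W * (pset_sem n U * pset_sem n V)].
Proof.
move=> dU dV U1 V1.
have [aU semU] := atomic_of_sets n W U dU U1.
have [aV semV] := atomic_of_sets n W V dV V1.
(* An empty set contributes the factor 1, so a single atom suffices; [pset_semM] fails there in
   general. *)
have [U0|U0] := eqVneq U set0.
  by exists (Atom aV); rewrite U0 pset_sem0 mul1r.
have [V0|V0] := eqVneq V set0.
  by exists (Atom aU); rewrite V0 pset_sem0 mulr1.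
have dUV : [disjoint W & U :|: V].
  by rewrite disjoint_sym disjoint_setU ![[disjoint _ & W]]disjoint_sym dU.
(* [U] is nonempty and not a singleton, so the union has at least two elements. *)
have UV1 : #|U :|: V| != 1%N.
  rewrite gtn_eqF //; apply: leq_trans (subset_leq_card (subsetUl U V)).
  by rewrite ltn_neqAle eq_sym U1 card_gt0.
have [aUV semUV] := atomic_of_sets n W _ dUV UV1.
exists (Uplus (Atom aU) (Uplus (Atom aV) (Atom aUV))); split=> //=.
by rewrite semU semV semUV pset_semM // !mulrDr.
Qed.

(** The set [V'] is [V] itself or empty. Being a subset of [V], it inherits disjointness from the
    prefix that [V] came with. *)
Lemma absorb_pset n (S V : {set 'I_n}) : #|V| != 1%N ->
  exists V' : {set 'I_n}, [/\ V' \subset V, [disjoint S & V'], #|V'| != 1%N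
    & mon S * pset_sem n V = mon S * pset_sem n V'].
Proof.
move=> V1; have [dSV|SV] := boolP [disjoint S & V]; first by exists V.
exists set0; rewrite sub0set cards0 pset_sem0 mulr1 mon_mul_pset //.
by split=> //; rewrite disjoint_sym disjoints_subset sub0set.
Qed.

Theorem mainTheorem4 (n : nat) (e f : atomic n) :
  exists p : expr n,
    [/\ is_ptp p, (natoms p <= 3)%N,
        sem p = atomic_sem e * atomic_sem f
      & sem_equiv (Odot (Atom e) (Atom f)) p].
Proof.
suff [p [ptp_p le_p sem_p]] : exists p : expr n,
    [/\ is_ptp p, (natoms p <= 3)%N & sem p = atomic_sem e * atomic_sem f].
  by exists p; split.
case De: e => [||S U wfSU].
- by exists (Atom PZero); rewrite /= mul0r.
- by exists (Atom f); rewrite /= mul1r.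
case: f => [||T V wfTV].
- by exists (Atom PZero); rewrite /= mulr0.
- by exists (Atom e); rewrite De /= mulr1.
rewrite /= !power_sem {De}.
case/and3P: wfSU => dSU U1 _; case/and3P: wfTV => dTV V1 _.
(* Each power set is reduced against the prefix of the other factor, which makes both disjoint from
   [S :|: T]. *)
have [U' [sU dTU' U'1 semU]] := absorb_pset n T U U1.
have [V' [sV dSV' V'1 semV]] := absorb_pset n S V V1.
have dSU' := disjointWr sU dSU; have dTV' := disjointWr sV dTV.
have [||p [ptp_p le_p sem_p]] := ptp_of_sets n (S :|: T) U' V' _ _ U'1 V'1.
- by rewrite disjoint_setU dSU'.
- by rewrite disjoint_setU dSV'.
exists p; split=> //.
(* Pairing [mon T] with [U'] and [mon S] with [V'] lets both reductions be undone. *)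
rewrite sem_p mon_setU [mon S * _]mulrC mulrACA -semU -semV.
by rewrite mulrACA [RHS]mulrACA; congr (_ * _); apply: mulrC.
Qed.
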